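(* Let $n\ge 1$, let $A$ be a symmetric non-positive definite (i.e. $A\le 0$) real $n\times n$ matrix, and let $L:T\mathbb{R}^n\to\mathbb{R}$ be the Lagrangian $$L(x,v)=\tfrac12|v|^2-\tfrac12\,x\cdot Ax .$$ For $T>0$ let $$c_T(x,y)=\inf\int_0^T L(\gamma(t),\dot\gamma(t))\,dt,$$ where the infimum is over all smooth curves $\gamma:[0,T]\to\mathbb{R}^n$ with $\gamma(0)=x$ and $\gamma(T)=y$. Then the cross-curvature $\mathcal C$ of the cost $c=c_T$ on $\mathbb{R}^n\times\mathbb{R}^n$ is identically zero.
   Context: Let $c$ be a cost on $\mathbb{R}^n\times\mathbb{R}^n$. For each $x$ let $\mathcal K_x=\{-d_xc(x,y): y\in\mathbb{R}^n\}\subset T_x^*\mathbb{R}^n$, where $d_xc(x,y)$ is the differential of $c(\cdot,y)$ at $x$. The $c$-exponential map is defined for $\alpha\in\mathcal K_x$ by letting $\exp^c(x,\alpha)$ be the point $y\in\mathbb{R}^n$ with $d_xc(x,y)=-\alpha$ (the map $y\mapsto d_xc(x,y)$ is injective). The cross-curvature of $c$ is $$\mathcal C_x(u,\alpha,\alpha_1)=-\frac32\,\partial_s^2\partial_t^2\, c\big(\gamma(t),\exp^c(x,\alpha+s\alpha_1)\big)\Big|_{t=s=0},\qquad u\in T_x\mathbb{R}^n,\ \alpha\in\mathcal K_x,\ \alpha_1\in T_x^*\mathbb{R}^n,$$ where $\gamma$ is any smooth curve with $\gamma(0)=x$, $\dot\gamma(0)=u$ (the value does not depend on the choice of $\gamma$).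 *)

(* Defs.v *)
From HB Require Import structures.
From mathcomp Require Import all_boot all_order all_algebra.
From mathcomp Require Import all_classical all_reals all_analysis.

Set Implicit Arguments.
Unset Strict Implicit.
Unset Printing Implicit Defensive.

Import Order.TTheory GRing.Theory Num.Theory.
Import numFieldNormedType.Exports.

Local Open Scope classical_set_scope.
Local Open Scope ring_scope.

(* Points and tangent vectors of R^n are rows; a covector is the column [a]
   standing for the linear form [v |-> (v *m a) 0 0]. *)

Section curves.
Context {R : realType} {n : nat}.

(* C^oo on a neighbourhood of [I]; for I = [0, T] this is smoothness up to the
   boundary. Values of [g] away from [I] are irrelevant. *)
Definition smooth_on (I : set R) (g : R -> 'rV[R]_n) :=
  exists2 U : set R, open U /\ I `<=` U &
    forall (k : nat) (t : R), U t -> derivable (g^`(k)%classic) t 1.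

Definition curves (T : R) (x y : 'rV[R]_n) : set (R -> 'rV[R]_n) :=
  [set g | [/\ smooth_on `[0, T] g, g 0 = x & g T = y]].

Definition action (L : 'rV[R]_n -> 'rV[R]_n -> R) (T : R) (g : R -> 'rV[R]_n) : R :=
  \int[lebesgue_measure]_(t in `[0, T]) L (g t) (g^`()%classic t).

Definition actions (L : 'rV[R]_n -> 'rV[R]_n -> R) (T : R) (x y : 'rV[R]_n) : set R :=
  action L T @` curves T x y.

Definition action_cost (L : 'rV[R]_n -> 'rV[R]_n -> R) (T : R) (x y : 'rV[R]_n) : R :=
  inf (actions L T x y).

End curves.

Section lagrangian.
Context {R : realType} {n : nat}.

Definition dot (u v : 'rV[R]_n) : R := (u *m v^T) 0 0.

(* [x *m A^T] is the row form of the column vector A x. *)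
Definition lagrangian (A : 'M[R]_n) (x v : 'rV[R]_n) : R :=
  2^-1 * dot v v - 2^-1 * dot x (x *m A^T).

Definition nonpositive_mx (A : 'M[R]_n) :=
  forall x : 'rV[R]_n, dot x (x *m A^T) <= 0.

End lagrangian.

Section mixed_derivatives.
Context {R : realType}.

Definition twice_derivable (f : R -> R) (a : R) :=
  (\forall t \near a, derivable f t 1) /\ derivable (f^`()%classic) a 1.

(* For F s t: the value at s = t = 0 of d_s^2 d_t^2 F. *)
Definition mixed22 (F : R -> R -> R) : R :=
  (fun s : R => (F s)^`(2)%classic 0)^`(2)%classic 0.

Definition mixed22_exists (F : R -> R -> R) :=
  (\forall s \near (0 : R), twice_derivable (F s) 0) /\
  twice_derivable (fun s : R => (F s)^`(2)%classic 0) 0.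

End mixed_derivatives.

Section cross_curvature.
Context {R : realType} {n : nat}.
Variable c : 'rV[R]_n -> 'rV[R]_n -> R.

Definition dxc (x y : 'rV[R]_n) : 'cV[R]_n :=
  \col_i ('d (c ^~ y) x (delta_mx 0 i)).

Definition cK (x : 'rV[R]_n) : set 'cV[R]_n := [set - dxc x y | y in setT].

(* The default value 0 is only taken for [a] outside [cK x]; the value at
   [a] in [cK x] is unambiguous when [dxc x] is injective. *)
Definition cexp (x : 'rV[R]_n) (a : 'cV[R]_n) : 'rV[R]_n :=
  xget 0 [set y | dxc x y = - a].

Definition cost_variation (g : R -> 'rV[R]_n) (x : 'rV[R]_n) (a a1 : 'cV[R]_n)
    (s t : R) : R :=
  c (g t) (cexp x (a + s *: a1)).

(* [r] is the cross-curvature at (x, u, a, a1): the defining expression is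
   meaningful and equals [r] whichever curve [g] through (x, u) is used. *)
Definition is_cross_curvature (x u : 'rV[R]_n) (a a1 : 'cV[R]_n) (r : R) :=
  forall g : R -> 'rV[R]_n,
    smooth_on [set 0] g -> g 0 = x -> g^`()%classic 0 = u ->
    [/\ \forall s \near (0 : R), cK x (a + s *: a1),
        mixed22_exists (cost_variation g x a a1) &
        - (3 / 2) * mixed22 (cost_variation g x a a1) = r].

End cross_curvature.

(* Main.v *)
(* Put B = - A >= 0. The minimizer from x to y solves gamma'' = gamma B, and
   along any competitor eta the Lagrangian equals the derivative of
   gamma'.eta - gamma.gamma'/2 plus the (nonnegative) Lagrangian of
   eta - gamma; hence c_T (x, y) = (gamma'(T).y - gamma'(0).x) / 2. After
   diagonalizing B, gamma is given by hyperbolic functions and the cost becomes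
   a quadratic form x.(x K)/2 + y.(y K)/2 - x.(y W) with W invertible. Its
   c-exponential map is affine in the covector, and the variation along
   (t, s) is affine in s up to a function of s alone, so that the mixed fourth
   derivative vanishes. *)
Require Import Defs.
From mathcomp Require Import all_boot all_order all_algebra.
From mathcomp Require Import complex ring.
From mathcomp Require Import all_classical all_reals all_analysis.

Import Order.TTheory GRing.Theory Num.Theory.
Import numFieldNormedType.Exports.

Local Open Scope classical_set_scope.
Local Open Scope ring_scope.

(** * Bilinear algebra of the dot product on rows *)

Section dot_algebra.
Context {R : realType} {n : nat}.
Implicit Types u v w : 'rV[R]_n.

Lemma dotE u v : dot u v = \sum_i u 0 i * v 0 i.
Proof. by rewrite /dot mxE; apply: eq_bigr => i _; rewrite mxE. Qed.

Lemma dotC u v : dot u v = dot v u.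
Proof. by rewrite !dotE; apply: eq_bigr => i _; rewrite mulrC. Qed.

Lemma dotDl u v w : dot (u + v) w = dot u w + dot v w.
Proof. by rewrite /dot mulmxDl mxE. Qed.

Lemma dotDr u v w : dot w (u + v) = dot w u + dot w v.
Proof. by rewrite dotC dotDl !(dotC w). Qed.

Lemma dotNl u v : dot (- u) v = - dot u v.
Proof. by rewrite /dot mulNmx mxE. Qed.

Lemma dotNr u v : dot u (- v) = - dot u v.
Proof. by rewrite dotC dotNl dotC. Qed.

Lemma dotZl (k : R) u v : dot (k *: u) v = k * dot u v.
Proof. by rewrite /dot -scalemxAl mxE. Qed.

Lemma dotZr (k : R) u v : dot u (k *: v) = k * dot u v.
Proof. by rewrite dotC dotZl dotC. Qed.

Lemma dot0r u : dot u 0 = 0.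
Proof. by rewrite /dot trmx0 mulmx0 mxE. Qed.

Lemma dot_mulmx u v (B : 'M[R]_n) : dot u (v *m B) = dot (u *m B^T) v.
Proof. by rewrite /dot trmx_mul mulmxA. Qed.

Lemma dot_ge0 u : 0 <= dot u u.
Proof. by rewrite dotE; apply: sumr_ge0 => i _; rewrite -expr2 sqr_ge0. Qed.

Lemma dot_gt0 u : u != 0 -> 0 < dot u u.
Proof.
move=> u0; rewrite lt_neqAle dot_ge0 andbT eq_sym dotE psumr_neq0.
  apply/hasP; have [i ui0] : exists i, u 0 i != 0 by apply/rV0Pn.
  by exists i; rewrite ?mem_index_enum // -expr2 lt0r sqr_ge0 sqrf_eq0 ui0.
by move=> i _; rewrite -expr2 sqr_ge0.
Qed.

Lemma dot_delta u i : dot u (delta_mx 0 i) = u 0 i.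
Proof.
rewrite dotE (bigD1 i) //= mxE !eqxx mulr1 big1 ?addr0 // => j ji.
by rewrite mxE (negbTE ji) andbF mulr0.
Qed.

End dot_algebra.

(** * Directional derivatives of matrix-valued maps *)

Section matrix_calculus.
Context {R : realType} {V : normedModType R}.

Lemma is_derive_mx {m p} (M : V -> 'M[R]_(m, p)) (dM : 'M[R]_(m, p)) t v :
  (forall i j, is_derive t v (fun x => M x i j) (dM i j)) -> is_derive t v M dM.
Proof.
move=> h; have Mv : derivable M t v.
  by apply/derivable_mxP => i j; case: (h i j).
split => //; rewrite derive_mx //; apply/matrixP => i j; rewrite mxE.
by case: (h i j).
Qed.

Lemma is_derive_coord {m p} (M : V -> 'M[R]_(m, p)) (dM : 'M[R]_(m, p)) t v i j :
  is_derive t v M dM -> is_derive t v (fun x => M x i j) (dM i j).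
Proof.
case=> Mv <-; split; first by move/derivable_mxP: Mv.
by rewrite derive_mx // mxE.
Qed.

Lemma is_derive_sum_fun {I : finType} (h : I -> V -> R) (dh : I -> R) t v :
  (forall i, is_derive t v (h i) (dh i)) ->
  is_derive t v (fun x => \sum_i h i x) (\sum_i dh i).
Proof.
move=> H; rewrite (_ : (fun x => _) = \sum_i h i).
  elim/big_ind2 : _ => [|f df g dg Hf Hg|i _]; [exact: is_derive_cst| |exact: H].
  exact: is_deriveD.
by apply/funext => x; rewrite fct_sumE.
Qed.

Lemma is_derive_mulmxr {m p q} (f : V -> 'M[R]_(m, p)) (df : 'M[R]_(m, p))
    (B : 'M[R]_(p, q)) t v :
  is_derive t v f df -> is_derive t v (fun x => f x *m B) (df *m B).
Proof.
move=> Hf; apply: is_derive_mx => i j.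
rewrite (_ : (fun x => _) = (fun x => \sum_k f x i k * B k j)); last first.
  by apply/funext => x; rewrite mxE.
rewrite mxE; apply: is_derive_sum_fun => k.
have Hk := is_derive_coord f df t v i k Hf.
apply: is_derive_eq (is_deriveM Hk (is_derive_cst (B k j) t v)) _.
by rewrite scaler0 add0r /GRing.scale /= mulrC.
Qed.

Lemma is_derive_dot {n} (f g : V -> 'rV[R]_n) (df dg : 'rV[R]_n) t v :
  is_derive t v f df -> is_derive t v g dg ->
  is_derive t v (fun x => dot (f x) (g x)) (dot df (g t) + dot (f t) dg).
Proof.
move=> Hf Hg.
rewrite (_ : (fun x => _) = (fun x => \sum_k f x 0 k * g x 0 k)); last first.
  by apply/funext => x; rewrite dotE.
rewrite !dotE -big_split /=; apply: is_derive_sum_fun => k.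
have Hfk := is_derive_coord f df t v 0 k Hf.
have Hgk := is_derive_coord g dg t v 0 k Hg.
apply: is_derive_eq (is_deriveM Hfk Hgk) _.
by rewrite /GRing.scale /= [g t 0 k * _]mulrC addrC.
Qed.

End matrix_calculus.

(** * Diagonalization of real symmetric matrices *)

Lemma mxminpoly_conj_diag {F : fieldType} {n : nat} (P : 'M[F]_n.+1) (D : 'rV[F]_n.+1) :
  P \in unitmx -> mxminpoly (invmx P *m diag_mx D *m P) = mxminpoly (diag_mx D).
Proof. by move=> Pu; rewrite -(conjVmx _ Pu) mxminpoly_uconj ?unitmx_inv. Qed.

(** Over the complex numbers [B] becomes Hermitian, hence diagonalizable with real spectrum. Its
    minimal polynomial is unchanged by the field extension, so it already splits into distinct
    linear factors over [R]. The resulting [P] is invertible but not claimed orthogonal. *)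
Lemma symmetric_mx_diagonalizable {R : realType} {n : nat} (B : 'M[R]_n) :
  B^T = B ->
  exists P (d : 'rV[R]_n), P \in unitmx /\ B = invmx P *m diag_mx d *m P.
Proof.
case: n B => [|n] B symB.
  by exists 1%:M, 0; rewrite unitmx1; split => //; apply/matrixP => -[].
pose f : {rmorphism R -> R[i]} := real_complex R.
pose Bc := map_mx f B.
have Bherm : Bc \is hermsymmx.
  apply/is_hermitianmxP; rewrite expr0 scale1r; apply/matrixP => i j.
  rewrite !mxE -[in LHS]symB mxE.
  by rewrite conj_Creal // complex_real.
have [P [D [Pu Dreal BcE]]] : exists P D,
    [/\ P \in unitmx, D \is a realmx & Bc = invmx P *m diag_mx D *m P].
  exists (spectralmx Bc), (spectral_diag Bc); split.
  - exact: spectral_unit.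
  - exact: hermitian_spectral_diag_real.
  - by apply/orthomx_spectralP/hermitian_normalmx.
pose d := map_mx (@complex.Re R) D.
have DE : D = map_mx f d.
  apply/matrixP => i j; rewrite !mxE.
  by have /mxOverP/(_ i j) := Dreal; rewrite /f /= => /RRe_real ->.
have minE : mxminpoly Bc = mxminpoly (diag_mx D).
  by rewrite BcE; exact: mxminpoly_conj_diag.
have diagB : diagonalizable B.
  apply/diagonalizableP; exists (undup [seq d 0 i | i <- enum 'I_n.+1]).
    exact: undup_uniq.
  rewrite -(dvdp_map f) -mxminpoly_map -/Bc minE DE -map_diag_mx mxminpoly_map.
  by rewrite dvdp_map mxminpoly_diag.
case: diagB => Q Qu /(diagonalizable_forLR Qu) [e Be].
exists Q, e; split; first exact: Qu.
by rewrite Be; exact: (conjVmx _ Qu).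
Qed.

(** The rows of [P] are nonzero left eigenvectors of [B]; testing nonnegativity on row i gives d_i
    |row_i|^2 >= 0. *)
Lemma symmetric_nonneg_mx_diagonalizable {R : realType} {n : nat} (B : 'M[R]_n) :
  B^T = B -> (forall x, 0 <= dot x (x *m B)) ->
  exists P (d : 'rV[R]_n), [/\ P \in unitmx, forall i, 0 <= d 0 i &
    B = invmx P *m diag_mx d *m P].
Proof.
move=> symB posB; have [P [d [Pu BE]]] := symmetric_mx_diagonalizable B symB.
exists P, d; split => // i.
have PB : row i P *m B = d 0 i *: row i P.
  rewrite BE !mulmxA -row_mul mulmxV // -[row i 1%:M *m _]row_mul mul1mx.
  by rewrite row_diag_mx -scalemxAl -rowE.
have := posB (row i P); rewrite PB dotZr pmulr_lge0 //; apply: dot_gt0.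
apply/eqP => Pi0; have : row i (P *m invmx P) = 0 by rewrite row_mul Pi0 mul0mx.
rewrite mulmxV // => /rowP/(_ i); rewrite !mxE eqxx => /eqP.
by rewrite oner_eq0.
Qed.

(** * Hyperbolic functions indexed by an eigenvalue *)

Section hyperbolic.
Context {R : realType}.
Implicit Types d t : R.

(** This is cosh (sqrt d * t). Indexing by [d] instead of its root lets the zero eigenvalue obey the
    same differentiation rules as the positive ones. *)
Definition hcos d t : R :=
  2^-1 * (expR (Num.sqrt d * t) + expR (- Num.sqrt d * t)).

(* sinh (sqrt d * t) / sqrt d, continued by t at d = 0. *)
Definition hsin d t : R :=
  if Num.sqrt d == 0 then t else
  (2 * Num.sqrt d)^-1 * (expR (Num.sqrt d * t) - expR (- Num.sqrt d * t)).

Lemma is_derive_expR_scale (w t : R) :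
  is_derive t 1 (fun t => expR (w * t)) (w * expR (w * t)).
Proof.
have H : is_derive t 1 (fun t => w * t) w.
  by apply: is_derive_eq (is_deriveZ w (is_derive_id t 1)) _; rewrite /GRing.scale /= mulr1.
by rewrite mulrC; exact: (is_derive1_comp (is_derive_expR (w * t)) H).
Qed.

Lemma is_derive_hcos d t : 0 <= d -> is_derive t 1 (hcos d) (d * hsin d t).
Proof.
move=> d0; set w := Num.sqrt d.
have wE : w ^+ 2 = d by rewrite sqr_sqrtr.
apply: is_derive_eq (is_deriveZ 2^-1
  (is_deriveD (is_derive_expR_scale w t) (is_derive_expR_scale (- w) t))) _.
rewrite /hsin -/w /GRing.scale /= -wE; case: eqP => [->|/eqP w0].
  by rewrite !mul0r expr2 !mul0r oppr0 mul0r addr0 mulr0.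
by field.
Qed.

Lemma is_derive_hsin d t : 0 <= d -> is_derive t 1 (hsin d) (hcos d t).
Proof.
move=> d0; set w := Num.sqrt d.
have [w0|w0] := eqVneq w 0.
  rewrite (_ : hsin d = id); last by apply/funext => s; rewrite /hsin -/w w0 eqxx.
  rewrite /hcos -/w w0 oppr0 !mul0r expR0.
  by apply: is_derive_eq (is_derive_id t 1) _; field.
rewrite (_ : hsin d = (2 * w)^-1 \*: ((fun t => expR (w * t)) - (fun t => expR (- w * t)))); last first.
  by apply/funext => s; rewrite /hsin -/w (negbTE w0).
apply: is_derive_eq (is_deriveZ (2 * w)^-1
  (is_deriveB (is_derive_expR_scale w t) (is_derive_expR_scale (- w) t))) _.
rewrite /hcos -/w /GRing.scale /=; by field.
Qed.

Lemma hcos0 d : hcos d 0 = 1.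
Proof. by rewrite /hcos !mulr0 expR0; field. Qed.

Lemma hsin0 d : hsin d 0 = 0.
Proof. by rewrite /hsin; case: ifP => //; rewrite !mulr0 subrr mulr0. Qed.

Lemma hcos2_sub d t : 0 <= d -> hcos d t ^+ 2 - d * hsin d t ^+ 2 = 1.
Proof.
move=> d0; rewrite /hcos /hsin; set w := Num.sqrt d.
have wE : w ^+ 2 = d by rewrite sqr_sqrtr.
(* Everything is rational in e = exp (w t) and w once exp (- w t) is written as 1 / e. *)
rewrite mulNr expRN -wE; have := expR_gt0 (w * t); set e := expR _ => e0.
case: eqP => [w0|/eqP w0].
  by rewrite /e w0 expr0n /= !mul0r expR0; field.
field; apply/andP; split => //; exact: lt0r_neq0.
Qed.

(** This positivity makes [sinh_mx d T] invertible, so that an extremal can be found between any two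
    endpoints. *)
Lemma hsin_gt0 d t : 0 < t -> 0 < hsin d t.
Proof.
move=> t0; rewrite /hsin; case: eqP => // /eqP w0.
have w_gt0 : 0 < Num.sqrt d by rewrite lt0r w0 sqrtr_ge0.
rewrite mulr_gt0 // ?invr_gt0 ?mulr_gt0 // subr_gt0 ltr_expR.
by rewrite ltr_pM2r // gtrN.
Qed.

End hyperbolic.

(** * Explicit extremals *)

Section fundamental_curves.
Context {R : realType} {n : nat} (P : 'M[R]_n) (d : 'rV[R]_n).
Hypothesis d_ge0 : forall i, 0 <= d 0 i.
Implicit Types p q : 'rV[R]_n.

Definition cosh_mx (t : R) : 'M[R]_n := diag_mx (\row_i hcos (d 0 i) t).

Definition sinh_mx (t : R) : 'M[R]_n := diag_mx (\row_i hsin (d 0 i) t).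

(* The solution of gamma'' = gamma P^-1 diag(d) P with gamma 0 = p P and
   gamma' 0 = q P. *)
Definition hyp_curve p q (t : R) : 'rV[R]_n :=
  (p *m cosh_mx t + q *m sinh_mx t) *m P.

(** Differentiation sends the data (p, q) to (q, p D), D = diag(d), and stays in the family. This
    yields smoothness by induction and, applied twice, the Euler-Lagrange equation. *)
Lemma is_derive_hyp_curve p q (t : R) :
  is_derive t 1 (hyp_curve p q) (hyp_curve q (p *m diag_mx d) t).
Proof.
apply: is_derive_mulmxr; apply: is_derive_mx => i j; rewrite (ord1 i).
rewrite (_ : (fun t : R => _) =
    (p 0 j \*: hcos (d 0 j)) + (q 0 j \*: hsin (d 0 j))); last first.
  by apply/funext => s; rewrite /cosh_mx /sinh_mx !mul_mx_diag !mxE.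
apply: is_derive_eq (is_deriveD
  (is_deriveZ (p 0 j) (is_derive_hcos _ t (d_ge0 j)))
  (is_deriveZ (q 0 j) (is_derive_hsin _ t (d_ge0 j)))) _.
by rewrite /cosh_mx /sinh_mx !mul_mx_diag !mxE /GRing.scale /= mulrA addrC.
Qed.

Lemma derive1_hyp_curve p q :
  (hyp_curve p q)^`()%classic = hyp_curve q (p *m diag_mx d).
Proof.
by apply/funext => t; rewrite derive1E; case: (is_derive_hyp_curve p q t).
Qed.

Lemma smooth_hyp_curve (I : set R) p q : smooth_on I (hyp_curve p q).
Proof.
exists setT; first by split => //; exact: openT.
move=> k t _.
have [p' [q' ->]] : exists p' q', (hyp_curve p q)^`(k)%classic = hyp_curve p' q'.
  elim: k => [|k [p' [q' IH]]]; first by exists p, q.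
  by rewrite derive1nS IH derive1_hyp_curve; exists q', (p' *m diag_mx d).
by case: (is_derive_hyp_curve p' q' t).
Qed.

Lemma hyp_curve0 p q : hyp_curve p q 0 = p *m P.
Proof.
rewrite /hyp_curve /cosh_mx /sinh_mx.
rewrite (_ : \row_i hcos _ _ = const_mx 1); last first.
  by apply/rowP => i; rewrite !mxE hcos0.
rewrite (_ : \row_i hsin _ _ = 0); last by apply/rowP => i; rewrite !mxE hsin0.
by rewrite diag_const_mx mulmx1 linear0 mulmx0 addr0.
Qed.

End fundamental_curves.

(** * Minimality of extremals by calibration *)

Section calibration.
Context {R : realType} {n : nat}.

Lemma derivable_continuous_within (f : R -> R) (a b : R) :
  (forall t, a <= t <= b -> derivable f t 1) -> {within `[a, b], continuous f}.
Proof.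
move=> df; apply: derivable_within_continuous => t; rewrite in_itv /=.
exact: df.
Qed.

Lemma derivable_oo_LRcontinuous_cc (f : R -> R) (a b : R) : a < b ->
  (forall t, a <= t <= b -> derivable f t 1) -> derivable_oo_LRcontinuous f a b.
Proof.
move=> ab df.
have cf t : a <= t <= b -> {for t, continuous f}.
  by move=> /df/derivable1_diffP; exact: differentiable_continuous.
split.
- by move=> t; rewrite in_itv /= => /andP[/ltW at_ /ltW tb]; apply: df; rewrite at_.
- by apply: cvg_at_right_filter; apply: cf; rewrite lexx ltW.
- by apply: cvg_at_left_filter; apply: cf; rewrite lexx ltW.
Qed.

Lemma Rintegral_derive (F f : R -> R) (a b : R) : a < b ->
  (forall t, a <= t <= b -> is_derive t 1 F (f t)) ->
  (forall t, a <= t <= b -> derivable f t 1) ->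
  \int[lebesgue_measure]_(t in `[a, b]) f t = F b - F a.
Proof.
move=> ab dF df; rewrite /Rintegral (@continuous_FTC2 _ f F a b) //.
- exact: derivable_continuous_within.
- by apply: derivable_oo_LRcontinuous_cc => // t /dF [].
move=> t; rewrite in_itv /= => /andP[/ltW at_ /ltW tb]; rewrite derive1E.
by have /dF [] : a <= t <= b by rewrite at_.
Qed.

Lemma le_Rintegral_derivable (f g : R -> R) (a b : R) :
  (forall t, a <= t <= b -> derivable f t 1) ->
  (forall t, a <= t <= b -> derivable g t 1) ->
  (forall t, a <= t <= b -> f t <= g t) ->
  \int[lebesgue_measure]_(t in `[a, b]) f t <=
  \int[lebesgue_measure]_(t in `[a, b]) g t.
Proof.
move=> df dg fg; apply: le_Rintegral => //.
- apply: continuous_compact_integrable; first exact: segment_compact.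
  exact: derivable_continuous_within.
- apply: continuous_compact_integrable; first exact: segment_compact.
  exact: derivable_continuous_within.
Qed.

Variables (A : 'M[R]_n) (T : R) (gam dgam : R -> 'rV[R]_n).
Hypotheses (symA : A^T = A) (negA : nonpositive_mx A) (T_gt0 : 0 < T).
Hypothesis d_gam : forall t : R, is_derive t 1 gam (dgam t).
Hypothesis d_dgam : forall t : R, is_derive t 1 dgam (- (gam t *m A)).

Let E (eta : R -> 'rV[R]_n) t :=
  dot (dgam t) (eta t) - 2^-1 * dot (gam t) (dgam t).

(** The time derivative of [E eta], with gamma'' already replaced by - gamma A. *)
Let e (eta deta : R -> 'rV[R]_n) t :=
  (dot (- (gam t *m A)) (eta t) + dot (dgam t) (deta t)) -
  2^-1 * (dot (dgam t) (dgam t) + dot (gam t) (- (gam t *m A))).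

Lemma is_derive_calibration eta deta (t : R) :
  is_derive t 1 eta (deta t) -> is_derive t 1 (E eta) (e eta deta t).
Proof.
move=> deta_t.
exact: (is_deriveB (is_derive_dot _ _ _ _ t 1 (d_dgam t) deta_t)
  (is_deriveZ 2^-1 (is_derive_dot _ _ _ _ t 1 (d_gam t) (d_dgam t)))).
Qed.

Lemma derivable_calibration_speed eta deta ddeta (t : R) :
  is_derive t 1 eta (deta t) -> is_derive t 1 deta ddeta ->
  derivable (e eta deta) t 1.
Proof.
move=> deta_t ddeta_t.
have dgamA : is_derive t 1 (fun t => - (gam t *m A)) (- (dgam t *m A)).
  exact: (is_deriveN (is_derive_mulmxr _ _ A t 1 (d_gam t))).
have := is_deriveB (is_deriveD (is_derive_dot _ _ _ _ t 1 dgamA deta_t)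
    (is_derive_dot _ _ _ _ t 1 (d_dgam t) ddeta_t))
  (is_deriveZ 2^-1 (is_deriveD (is_derive_dot _ _ _ _ t 1 (d_dgam t) (d_dgam t))
     (is_derive_dot _ _ _ _ t 1 (d_gam t) dgamA))).
by case=> h _; exact: h.
Qed.

Lemma derivable_lagrangian eta deta ddeta (t : R) :
  is_derive t 1 eta (deta t) -> is_derive t 1 deta ddeta ->
  derivable (fun t => lagrangian A (eta t) (deta t)) t 1.
Proof.
move=> deta_t ddeta_t.
have := is_deriveB (is_deriveZ 2^-1 (is_derive_dot _ _ _ _ t 1 ddeta_t ddeta_t))
  (is_deriveZ 2^-1 (is_derive_dot _ _ _ _ t 1 deta_t
     (is_derive_mulmxr _ _ A^T t 1 deta_t))).
by case=> h _; exact: h.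
Qed.

(* The Weierstrass excess is the Lagrangian of the difference, which is
   nonnegative because A <= 0. *)
Lemma lagrangian_calibration eta deta t :
  lagrangian A (eta t) (deta t) =
  e eta deta t + lagrangian A (eta t - gam t) (deta t - dgam t).
Proof.
rewrite /lagrangian /e symA !(mulmxDl, mulNmx) !(dotDl, dotDr, dotNl, dotNr).
rewrite [dot (gam t) (eta t *m A)]dot_mulmx symA.
rewrite (dotC (deta t) (dgam t)) (dotC (gam t *m A) (eta t)).
by field.
Qed.

Lemma lagrangian_ge0 x v : 0 <= lagrangian A x v.
Proof.
rewrite /lagrangian subr_ge0; apply: le_trans (_ : 0 <= _).
  by rewrite mulr_ge0_le0 // invr_ge0.
by rewrite mulr_ge0 ?dot_ge0 // invr_ge0.
Qed.

(** The increment of [E] over [0, T] sees only the endpoints of the competitor; this is its common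
    value for all curves sharing the endpoints of [gam]. *)
Let V := 2^-1 * (dot (dgam T) (gam T) - dot (dgam 0) (gam 0)).

Let E_end eta : eta 0 = gam 0 -> eta T = gam T -> E eta T - E eta 0 = V.
Proof.
move=> e0 eT; rewrite /E /V e0 eT ![dot (gam _) _]dotC; by field.
Qed.

(** The endpoints 0 and T give two-sided derivatives too, because smoothness is required on an open
    set around the interval. *)
Lemma is_derive_smooth_on (eta : R -> 'rV[R]_n) (t : R) : smooth_on `[0, T] eta ->
  0 <= t <= T -> is_derive t 1 eta (eta^`()%classic t) /\
    derivable (eta^`()%classic) t 1.
Proof.
move=> [U [_ IU] H] tT; have Ut : U t by apply: IU; rewrite /= in_itv.
split; last exact: (H 1%N t Ut).
by split; [exact: (H 0%N t Ut)|rewrite derive1E].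
Qed.

(** The Lagrangian along [eta] dominates [e], whose integral is the increment of [E]. *)
Lemma action_ge_calibration x y eta : gam 0 = x -> gam T = y ->
  curves T x y eta -> V <= action (lagrangian A) T eta.
Proof.
move=> <- <- [seta e0 eT]; rewrite -(E_end _ e0 eT).
have d1 t : 0 <= t <= T -> is_derive t 1 eta (eta^`()%classic t).
  by move=> /(is_derive_smooth_on _ _ seta) [].
have d2 t : 0 <= t <= T -> is_derive t 1 (eta^`()%classic) ('D_1 (eta^`()%classic) t).
  by move=> /(is_derive_smooth_on _ _ seta) [_ /derivableP].
have <- : \int[lebesgue_measure]_(t in `[0, T]) e eta (eta^`()%classic) t =
    E eta T - E eta 0.
  apply: Rintegral_derive => // t tT.
    exact: is_derive_calibration (d1 t tT).
  exact: derivable_calibration_speed (d1 t tT) (d2 t tT).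
apply: le_Rintegral_derivable => t tT.
- exact: derivable_calibration_speed (d1 t tT) (d2 t tT).
- exact: derivable_lagrangian (d1 t tT) (d2 t tT).
- by rewrite [leRHS]lagrangian_calibration lerDl lagrangian_ge0.
Qed.

(** For eta = gamma the excess is the Lagrangian of the zero curve, so the bound is an equality. *)
Lemma action_calibrated : action (lagrangian A) T gam = V.
Proof.
rewrite -(E_end gam erefl erefl) /action.
have dgE : gam^`()%classic = dgam.
  by apply/funext => t; rewrite derive1E; case: (d_gam t).
have <- : \int[lebesgue_measure]_(t in `[0, T]) e gam dgam t =
    E gam T - E gam 0.
  apply: Rintegral_derive => // t tT; first exact: is_derive_calibration.
  exact: derivable_calibration_speed (d_gam t) (d_dgam t).
apply: eq_Rintegral => t _; rewrite dgE lagrangian_calibration.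
by rewrite !subrr /lagrangian mul0mx /dot !mul0mx !mxE !mulr0 subrr addr0.
Qed.

(** [V] is a lower bound attained by [gam], so the infimum is a minimum. [has_inf] is recorded
    because [inf] takes a default value on sets without an infimum. *)
Lemma extremal_action_cost x y : curves T x y gam ->
  has_inf (actions (lagrangian A) T x y) /\
  action_cost (lagrangian A) T x y = 2^-1 * (dot (dgam T) y - dot (dgam 0) x).
Proof.
move=> cgam; have [sgam g0 gT] := cgam.
have lb : lbound (actions (lagrangian A) T x y) V.
  by move=> _ [eta ceta <-]; apply: action_ge_calibration ceta.
have Vin : actions (lagrangian A) T x y V.
  by exists gam => //; exact: action_calibrated.
have hinf : has_inf (actions (lagrangian A) T x y) by split; [exists V|exists V].
split => //; rewrite -g0 -gT -/V g0 gT /action_cost; apply/eqP.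
rewrite eq_le ge_inf //=; last by exists V.
by apply: lb_le_inf => //; exists V.
Qed.

End calibration.

(** * The action cost as a quadratic form *)

(** Symmetry of P^-1 diag(d) P means that the Gram matrix M = P P^T commutes with diag(d), so M_ij =
    0 unless d_i = d_j. There e_i = e_j as well, hence M commutes with diag(e). Thus functions of a
    symmetric matrix are symmetric although [P] need not be orthogonal. *)
Lemma conj_diag_mx_sym {F : fieldType} {n : nat} (P : 'M[F]_n) (d e : 'rV[F]_n) :
  P \in unitmx -> (forall i j, d 0 i = d 0 j -> e 0 i = e 0 j) ->
  (invmx P *m diag_mx d *m P)^T = invmx P *m diag_mx d *m P ->
  (invmx P *m diag_mx e *m P)^T = invmx P *m diag_mx e *m P.
Proof.
move=> Pu de symd; pose M := P *m P^T.
have MD : M *m diag_mx d = diag_mx d *m M.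
  have PTu : P^T \in unitmx by rewrite unitmx_tr.
  move: symd => /(congr1 (fun X => P *m X *m P^T)).
  rewrite !trmx_mul tr_diag_mx trmx_inv !mulmxA mulmxV // mul1mx.
  by rewrite mulmxKV // /M !mulmxA.
have ME : M *m diag_mx e = diag_mx e *m M.
  apply/matrixP => i j; rewrite mul_mx_diag mul_diag_mx !mxE.
  have [Mij|Mij] := eqVneq (M i j) 0; first by rewrite !mxE in Mij; rewrite Mij mulr0 mul0r.
  move/matrixP/(_ i j): MD; rewrite mul_mx_diag mul_diag_mx mxE [in RHS]mxE mulrC.
  by move/(mulIf Mij)/esym/de => ->; rewrite mulrC.
have PTu : P^T \in unitmx by rewrite unitmx_tr.
rewrite !trmx_mul tr_diag_mx trmx_inv mulmxA.
apply: (can_inj (mulmxK PTu)); apply: (can_inj (mulKmx Pu)).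
by rewrite mulmxKV // !mulmxA mulmxV // mul1mx -/M ME mulmxA.
Qed.

Section quadratic_cost.
Context {R : realType} {n : nat}.

(** One matrix [K] serves both endpoints: the Lagrangian is even in the velocity, so reversing time
    exchanges them. *)
Definition quadratic_cost (K W : 'M[R]_n) (x y : 'rV[R]_n) : R :=
  2^-1 * dot x (x *m K) + 2^-1 * dot y (y *m K) - dot x (y *m W).

(** With B = - A, the matrices are K = sqrt B coth (T sqrt B) and W = sqrt B / sinh (T sqrt B), both
    read as 1 / T on the kernel of B. *)
Lemma action_cost_quadratic (A : 'M[R]_n) (T : R) :
  A^T = A -> nonpositive_mx A -> 0 < T ->
  exists K W : 'M[R]_n, [/\ K^T = K, W^T = W, W \in unitmx &
    forall x y, has_inf (actions (lagrangian A) T x y) /\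
      action_cost (lagrangian A) T x y = quadratic_cost K W x y].
Proof.
move=> symA negA T0.
have symB : (- A)^T = - A by rewrite linearN /= symA.
have [P [d [Pu d0 BE]]] : exists P (d : 'rV[R]_n), [/\ P \in unitmx,
    forall i, 0 <= d 0 i & - A = invmx P *m diag_mx d *m P].
  apply: symmetric_nonneg_mx_diagonalizable => // x.
  by rewrite mulmxN dotNr -symA oppr_ge0.
pose C := cosh_mx d T; pose S := sinh_mx d T.
pose Si : 'M[R]_n := diag_mx (\row_i (hsin (d 0 i) T)^-1).
pose D : 'M[R]_n := diag_mx d.
have hS i : hsin (d 0 i) T != 0 by rewrite gt_eqF // hsin_gt0.
have SiS : Si *m S = 1%:M.
  rewrite -diag_const_mx mulmx_diag; congr diag_mx; apply/rowP => i.
  by rewrite !mxE mulVf.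
have CSi : C *m Si = diag_mx (\row_i (hcos (d 0 i) T / hsin (d 0 i) T)).
  by rewrite mulmx_diag; congr diag_mx; apply/rowP => i; rewrite !mxE.
(* Entrywise this is c^2 / s = 1 / s + d s, from c^2 - d s^2 = 1. *)
have CSiC : C *m Si *m C = Si + D *m S.
  rewrite CSi !mulmx_diag -raddfD /=; congr diag_mx; apply/rowP => i; rewrite !mxE.
  have := hcos2_sub (d 0 i) T (d0 i); set c := hcos _ _; set s := hsin _ _ => H.
  have s0 : s != 0 by exact: hS.
  by rewrite -[X in _ = X + _]mul1r -H; field.
pose K := invmx P *m (C *m Si) *m P; pose W := invmx P *m Si *m P.
have symK : K^T = K.
  rewrite /K CSi; apply: (conj_diag_mx_sym P d _ Pu); last by rewrite -BE.
  by move=> i j dij; rewrite !mxE dij.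
have symW : W^T = W.
  apply: (conj_diag_mx_sym P d _ Pu); last by rewrite -BE.
  by move=> i j dij; rewrite !mxE dij.
have Wu : W \in unitmx.
  rewrite !unitmx_mul unitmx_inv Pu /= andbT.
  by have /mulmx1_unit [] := SiS.
exists K, W; split => // x y.
(* In eigencoordinates p is the initial position, and q is the initial velocity solving p C + q S =
   y P^-1. *)
pose p := x *m invmx P; pose q := (y *m invmx P - p *m C) *m Si.
pose gam := hyp_curve P d p q; pose dgam := hyp_curve P d q (p *m D).
have d_gam (t : R) : is_derive t 1 gam (dgam t) by exact: is_derive_hyp_curve.
have d_dgam (t : R) : is_derive t 1 dgam (- (gam t *m A)).
  rewrite -mulmxN BE /gam /hyp_curve !mulmxA mulmxK //.
  have -> : (p *m cosh_mx d t + q *m sinh_mx d t) *m diag_mx d =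
      p *m D *m cosh_mx d t + q *m D *m sinh_mx d t.
    by rewrite mulmxDl -!mulmxA /D diag_mxC [sinh_mx d t *m _]diag_mxC.
  exact: is_derive_hyp_curve.
have gam0 : gam 0 = x by rewrite /gam hyp_curve0 /p mulmxKV.
have gamT : gam T = y.
  rewrite /gam /hyp_curve -/C -/S /q -mulmxA SiS mulmx1 addrC subrK.
  by rewrite mulmxKV.
have cgam : curves T x y gam by split => //; exact: smooth_hyp_curve.
have [hinf ->] := extremal_action_cost A T gam dgam symA negA T0 d_gam d_dgam x y cgam.
split => //.
have -> : dgam 0 = y *m W - x *m K.
  by rewrite /dgam hyp_curve0 /q /p /W /K !(mulmxBl, mulmxA).
(* In eigencoordinates the final velocity is q C + p D S. The x-part of q C is - p (Si + D S), by
   [CSiC], and its second term cancels p D S. *)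
have -> : dgam T = y *m K - x *m W.
  rewrite /dgam /hyp_curve -/C -/S /q -mulmxA.
  have -> : Si *m C = C *m Si by exact: diag_mxC.
  rewrite mulmxBl -[p *m C *m _]mulmxA [C *m (C *m Si)]mulmxA.
  have -> : C *m C *m Si = Si + D *m S.
    by rewrite -CSiC -!mulmxA; congr (_ *m _); exact: diag_mxC.
  rewrite mulmxDr opprD addrA !mulmxA subrK mulmxBl.
  by [].
(* The two cross terms, each with factor 1/2, coincide by symmetry of [W]. *)
rewrite /quadratic_cost !(dotDl, dotNl) (dotC (y *m K)) (dotC (x *m K)).
rewrite (dotC (y *m W)) [dot x (y *m W)]dot_mulmx symW.
by field.
Qed.

End quadratic_cost.

(** * Second derivatives at a point *)

Section second_derivative.
Context {R : realType}.

(** A second derivative depends only on the germ: [df] agrees with the derivative of [f] near [a],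
    so both have the same derivative at [a]. A local formula suits curves that are smooth only near
    0. *)
Lemma twice_derivableP (f df : R -> R) (ddf a : R) :
  (\forall t \near a, is_derive (t : R) 1 f (df t)) -> is_derive a 1 df ddf ->
  twice_derivable f a /\ f^`(2)%classic a = ddf.
Proof.
move=> Hf Hdf.
have dfE : {near a, df =1 f^`()%classic}.
  by apply: filterS Hf => t [_ Et]; rewrite derive1E.
have [Hd Hv] := Hdf.
split; first split.
- by apply: filterS Hf => t [].
- exact: near_eq_derivable dfE Hd.
rewrite derive1nS derive1n1 derive1E -Hv.
by apply/esym; exact: near_eq_derive dfE.
Qed.

End second_derivative.

(** * Cross-curvature of a quadratic cost *)

Section quadratic_cost_curvature.
Context {R : realType} {n : nat} (K W : 'M[R]_n).
Hypotheses (symK : K^T = K) (symW : W^T = W) (Wu : W \in unitmx).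

Let c := quadratic_cost K W.

(** [dxc] is built on the differential, which can be computed from directional derivatives once
    differentiability is known. The latter holds because the form is polynomial in the
    coordinates. *)
Lemma differentiable_dot_mulmx (M : 'M[R]_n) (x : 'rV[R]_n) :
  differentiable (fun x : 'rV[R]_n => dot x (x *m M)) x.
Proof.
rewrite (_ : (fun x => _) = \sum_(k < n) (fun x : 'rV[R]_n =>
    x 0 k * (\sum_(l < n) (fun x : 'rV[R]_n => x 0 l * M l k)) x)); last first.
  apply/funext => y; rewrite dotE fct_sumE; apply: eq_bigr => k _.
  by rewrite mxE fct_sumE.
apply: differentiable_sum => k; apply: differentiableM.
  exact: differentiable_coord.
apply: differentiable_sum => l; apply: differentiableM.
  exact: differentiable_coord.
exact: differentiable_cst.
Qed.

Lemma differentiable_dotl (z x : 'rV[R]_n) :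
  differentiable (fun x : 'rV[R]_n => dot x z) x.
Proof.
rewrite (_ : (fun x => _) = \sum_(k < n) (fun x : 'rV[R]_n => x 0 k * z 0 k)).
  apply: differentiable_sum => k; apply: differentiableM.
    exact: differentiable_coord.
  exact: differentiable_cst.
by apply/funext => y; rewrite dotE fct_sumE.
Qed.

Lemma differentiable_quadratic_cost (x y : 'rV[R]_n) : differentiable (c ^~ y) x.
Proof.
apply: differentiableB; last exact: differentiable_dotl.
apply: differentiableD; last exact: differentiable_cst.
exact: (differentiableZ 2^-1 (differentiable_dot_mulmx K x)).
Qed.

Lemma is_derive_quadratic_cost (x y v : 'rV[R]_n) :
  is_derive x v (c ^~ y) (dot (x *m K - y *m W) v).
Proof.
have Did : is_derive x v (id : 'rV[R]_n -> 'rV[R]_n) v by exact: is_derive_id.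
have DK := is_derive_mulmxr _ _ K x v Did.
apply: is_derive_eq (is_deriveB (is_deriveD
  (is_deriveZ 2^-1 (is_derive_dot _ _ _ _ x v Did DK))
  (is_derive_cst (2^-1 * dot y (y *m K)) x v))
  (is_derive_dot _ _ _ _ x v Did (is_derive_cst (y *m W) x v))) _.
(* Symmetry of [K] merges the two halves of the product rule into x K. *)
rewrite /cst /GRing.scale /= [dot x (v *m K)]dot_mulmx symK !(dotC v) dot0r !addr0.
by rewrite dotDl dotNl; field.
Qed.

Lemma dxc_quadratic_cost (x y : 'rV[R]_n) : dxc c x y = (x *m K - y *m W)^T.
Proof.
apply/colP => i; rewrite !mxE -deriveE; last exact: differentiable_quadratic_cost.
have [_ ->] := is_derive_quadratic_cost x y (delta_mx 0 i).
by rewrite dot_delta !mxE.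
Qed.

(** The second point enters [dxc] only through y W, with [W] invertible. *)
Lemma injective_dxc_quadratic_cost (x : 'rV[R]_n) : injective (dxc c x).
Proof.
move=> y y'; rewrite !dxc_quadratic_cost => /trmx_inj/addrI/oppr_inj.
exact: (can_inj (mulmxK Wu)).
Qed.

(** The point solves x K - y W = - a^T for y. Hence every covector is admissible and the
    c-exponential is affine in it. *)
Lemma dxc_quadratic_costV (x : 'rV[R]_n) (a : 'cV[R]_n) :
  dxc c x ((x *m K + a^T) *m invmx W) = - a.
Proof.
by rewrite dxc_quadratic_cost mulmxKV // opprD addNKr linearN /= trmxK.
Qed.

Lemma cK_quadratic_cost (x : 'rV[R]_n) (a : 'cV[R]_n) : cK c x a.
Proof. by exists ((x *m K + a^T) *m invmx W); rewrite // dxc_quadratic_costV opprK. Qed.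

(** [xget] picks some solution; injectivity identifies it with the explicit one. *)
Lemma cexp_quadratic_cost (x : 'rV[R]_n) (a : 'cV[R]_n) :
  cexp c x a = (x *m K + a^T) *m invmx W.
Proof.
apply: (injective_dxc_quadratic_cost x); rewrite dxc_quadratic_costV.
apply: (@xgetPex _ 0 [set y | dxc c x y = - a]).
by exists ((x *m K + a^T) *m invmx W); exact: dxc_quadratic_costV.
Qed.

(* The only term coupling s and t is affine in s, because the c-exponential
   map is affine. *)
Lemma cost_variation_quadratic (g : R -> 'rV[R]_n) (x : 'rV[R]_n)
    (a a1 : 'cV[R]_n) (s : R) :
  cost_variation c g x a a1 s =
  (fun t => 2^-1 * dot (g t) (g t *m K) +
    2^-1 * dot (cexp c x (a + s *: a1)) (cexp c x (a + s *: a1) *m K) -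
    dot (g t) (x *m K + a^T + s *: a1^T)).
Proof.
apply/funext => t; rewrite /cost_variation {1}/c /quadratic_cost.
congr (_ - dot _ _).
by rewrite cexp_quadratic_cost mulmxKV // linearD linearZ /= addrA.
Qed.

Lemma is_cross_curvature_quadratic_cost (x u : 'rV[R]_n) (a a1 : 'cV[R]_n) :
  is_cross_curvature c x u a a1 0.
Proof.
move=> g [U [Uopen /(_ 0 erefl) U0] smg] g0 g'0.
pose g1 := g^`()%classic; pose g2 := g1^`()%classic.
have Dg (t : R) : U t -> is_derive t 1 g (g1 t).
  by move=> Ut; split; [exact: (smg 0%N)|rewrite /g1 derive1E].
have Dg1 (t : R) : U t -> is_derive t 1 g1 (g2 t).
  by move=> Ut; split; [exact: (smg 1%N)|rewrite /g2 derive1E].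
have nU : \forall t \near (0 : R), U t by apply: open_nbhs_nbhs.
pose z s := x *m K + a^T + s *: a1^T.
pose h t := 2^-1 * (dot (g1 t) (g t *m K) + dot (g t) (g1 t *m K)).
pose k : R := 2^-1 *
  ((dot (g2 0) (g 0 *m K) + dot (g1 0) (g1 0 *m K)) +
   (dot (g1 0) (g1 0 *m K) + dot (g 0) (g2 0 *m K))).
(* The term in the c-exponential alone is constant in t and drops out. What remains is [k], free of
   s, and a pairing with [z s], affine in s. *)
have inner (s : R) : twice_derivable (cost_variation c g x a a1 s) 0 /\
    (cost_variation c g x a a1 s)^`(2)%classic 0 = k - dot (g2 0) (z s).
  apply: (@twice_derivableP _ _ (fun t => h t - dot (g1 t) (z s))).
    (* The first-derivative formula is available only on [U], where [g] is smooth. *)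
    apply: filterS nU => t Ut; rewrite cost_variation_quadratic.
    have DgK := is_derive_mulmxr _ _ K t 1 (Dg t Ut).
    apply: is_derive_eq (is_deriveB (is_deriveD
      (is_deriveZ 2^-1 (is_derive_dot _ _ _ _ t 1 (Dg t Ut) DgK))
      (is_derive_cst (2^-1 * dot (cexp c x (a + s *: a1))
         (cexp c x (a + s *: a1) *m K)) t 1))
      (is_derive_dot _ _ _ _ t 1 (Dg t Ut) (is_derive_cst (z s) t 1))) _.
    by rewrite addr0 dot0r addr0.
  have DgK := is_derive_mulmxr _ _ K (0 : R) 1 (Dg 0 U0).
  have Dg1K := is_derive_mulmxr _ _ K (0 : R) 1 (Dg1 0 U0).
  apply: is_derive_eq (is_deriveB (is_deriveZ 2^-1 (is_deriveD
      (is_derive_dot _ _ _ _ (0 : R) 1 (Dg1 0 U0) DgK)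
      (is_derive_dot _ _ _ _ (0 : R) 1 (Dg 0 U0) Dg1K)))
    (is_derive_dot _ _ _ _ (0 : R) 1 (Dg1 0 U0) (is_derive_cst (z s) (0 : R) 1))) _.
  by rewrite dot0r addr0.
have outer : twice_derivable (fun s => (cost_variation c g x a a1 s)^`(2)%classic 0) 0 /\
    mixed22 (cost_variation c g x a a1) = 0.
  rewrite /mixed22.
  have -> : (fun s => (cost_variation c g x a a1 s)^`(2)%classic 0) =
      (fun s : R => (k - dot (g2 0) (x *m K + a^T)) - dot (g2 0) a1^T * s).
    by apply/funext => s; rewrite (inner s).2 /z dotDr dotZr; ring.
  (* An affine function of s has constant first derivative, hence zero second derivative. *)
  apply: (@twice_derivableP _ _ (cst (- dot (g2 0) a1^T))).
    apply: filterE => s.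
    apply: is_derive_eq (is_deriveB
      (is_derive_cst (k - dot (g2 0) (x *m K + a^T)) s 1)
      (is_deriveZ (dot (g2 0) a1^T) (is_derive_id s (1 : R)))) _.
    by rewrite sub0r /GRing.scale /= mulr1.
split.
- by apply: filterE => s; exact: cK_quadratic_cost.
- by split; [apply: filterE => s; exact: (inner s).1|exact: outer.1].
- by rewrite outer.2 mulr0.
Qed.

End quadratic_cost_curvature.

(** The first three clauses make the last one meaningful: the infimum is genuine, the differential
    exists, and the c-exponential is single-valued. *)
Theorem theorem1p1 (R : realType) (n : nat) (hn : (1 <= n)%N) (A : 'M[R]_n)
    (hsym : A^T = A) (hneg : nonpositive_mx A) (T : R) (hT : 0 < T) :
  let L := lagrangian A in
  let c := action_cost L T in
  [/\ forall x y : 'rV[R]_n, has_inf (actions L T x y),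
      forall x y : 'rV[R]_n, differentiable (c ^~ y) x,
      forall x : 'rV[R]_n, injective (dxc c x) &
      forall (x u : 'rV[R]_n) (a a1 : 'cV[R]_n),
        cK c x a -> is_cross_curvature c x u a a1 0].
Proof.
move=> L c.
have [K [W [symK symW Wu H]]] := action_cost_quadratic A T hsym hneg hT.
have -> : c = quadratic_cost K W.
  by apply/funext => x; apply/funext => y; exact: (H x y).2.
split.
- by move=> x y; exact: (H x y).1.
- exact: differentiable_quadratic_cost.
- exact: injective_dxc_quadratic_cost.
- by move=> x u a a1 _; exact: is_cross_curvature_quadratic_cost.
Qed.
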